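(* $\mathcal{Z}$ acts trivially on every irreducible cuspidal module over $\mathcal{V}ir$, and $\mathcal Z$ acts trivially on every irreducible cuspidal module over $\tau$.
   Context: All vector spaces are over $\mathbb{C}$; $n\geqslant 1$ is an integer; $\mathfrak{g}$ is a finite-dimensional simple Lie algebra with a symmetric non-degenerate invariant bilinear form $(\cdot|\cdot)$. Let $A=\mathbb{C}[t_0^{\pm1},\dots,t_n^{\pm1}]$ and $t^{\underline k}=t_0^{k_0}\cdots t_n^{k_n}$ for $\underline k\in\mathbb{Z}^{n+1}$. Let $\Omega_A$ be the free $A$-module with basis $K_0,\dots,K_n$, $d:A\to\Omega_A$ the linear map $d(t^{\underline k})=\sum_i k_i t^{\underline k}K_i$, and $\mathcal{Z}=\Omega_A/dA$; the image of $t^{\underline k}K_i$ in $\mathcal Z$ is again denoted $t^{\underline k}K_i$. Let $d_i=t_i\partial/\partial t_i$ and $\mathcal{W}_{n+1}=\mathrm{span}\{t^{\underline r}d_i\}=\mathrm{Der}(A)$. Put $\phi_1(t^{\underline r}d_i,t^{\underline s}d_j)=-s_ir_j\sum_p r_pt^{\underline r+\underline s}K_p$, $\phi_2(t^{\underline r}d_i,t^{\underline s}d_j)=r_is_j\sum_p r_pt^{\underline r+\underline s}K_p$, and let $\phi$ be an arbitrary fixed linear combination of $\phi_1,\phi_2$. The full toroidal Lie algebra is $\tau=(\mathfrak g\otimes A)\oplus\mathcal Z\oplus\mathcal W_{n+1}$ with brackets: $[x\otimes t^{\underline k},y\otimes t^{\underline l}]=[x,y]\otimes t^{\underline k+\underline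 l}+(x|y)\sum_i k_it^{\underline k+\underline l}K_i$; $\mathcal Z$ is abelian and commutes with $\mathfrak g\otimes A$; $[t^{\underline r}d_i,t^{\underline s}K_j]=s_it^{\underline r+\underline s}K_j+\delta_{ij}\sum_p r_pt^{\underline r+\underline s}K_p$; $[t^{\underline r}d_i,t^{\underline s}d_j]=s_it^{\underline r+\underline s}d_j-r_jt^{\underline r+\underline s}d_i+\phi(t^{\underline r}d_i,t^{\underline s}d_j)$; $[t^{\underline r}d_i,x\otimes t^{\underline s}]=s_i\,x\otimes t^{\underline r+\underline s}$. The higher-dimensional Virasoro algebra is the subalgebra $\mathcal{V}ir=\mathcal Z\oplus\mathcal W_{n+1}$ of $\tau$. Let $D=\mathrm{span}\{d_0,\dots,d_n\}$; $\underline m\in\mathbb{Z}^{n+1}$ is identified with the functional $d_i\mapsto m_i$ in $D^*$. For a module $V$ over $\tau$ (or $\mathcal{V}ir$) and $\mu\in D^*$ put $V_\mu=\{v:d_iv=\mu(d_i)v\ \forall i\}$. $V$ is a Harish-Chandra module if, for some $\lambda\in D^*$, $V=\bigoplus_{\underline m\in\mathbb{Z}^{n+1}}V_{\lambda+\underline m}$ with all $V_{\lambda+\underline m}$ finite-dimensional; it is cuspidal if moreover there is $N_0\in\mathbb N$ with $\dim V_{\lambda+\underline m}\le N_0$ for all $\underline m$. *)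

(* Defs.v *)
From HB Require Import structures.
From mathcomp Require Import all_boot all_order all_algebra.
From mathcomp Require Import finmap complex.
From mathcomp Require Import boolp classical_sets functions cardinality fsbigop.
From mathcomp Require Import reals.

Set Implicit Arguments.
Unset Strict Implicit.
Unset Printing Implicit Defensive.

Import GRing.Theory Num.Theory.
Local Open Scope classical_set_scope.
Local Open Scope ring_scope.

Section FiniteSupport.
Variables (K : nzRingType) (n : nat) (V : lmodType K).
Local Notation Zn := 'rV[int]_n.+1.

Definition supp (f : Zn -> V) : set Zn := [set i | f i != 0].

Definition fin_supp : {pred (Zn -> V)} := fun f => `[< finite_set (supp f) >].

Lemma fin_supp_submod : submod_closed fin_supp.
Proof.
split=> [|a f g /asboolP ff /asboolP fg]; apply/asboolP.
  apply: sub_finite_set (@finite_set0 Zn) => i; rewrite /supp /=.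
  by rewrite [X in X != 0](_ : _ = 0) ?eqxx.
apply: sub_finite_set (_ : finite_set (supp f `|` supp g)); last first.
  by rewrite finite_setU.
move=> i; rewrite /supp /=; apply: contraPP => /not_orP[].
move=> /negP; rewrite negbK => /eqP fi /negP; rewrite negbK => /eqP gi.
rewrite [X in X != 0](_ : _ = a *: f i + g i) //.
by rewrite fi gi scaler0 addr0 eqxx.
Qed.

HB.instance Definition _ :=
  GRing.isSubmodClosed.Build K (Zn -> V) fin_supp fin_supp_submod.

(* V (x) A, as finitely supported families: a stands for \sum_k a_k (x) t^k,
   and mono k v below for v (x) t^k. The exponents k lie in Z^(n+1), the n+1
   variables being t_0, ..., t_n. *)
Record laurent := Laurent { coef :> Zn -> V; _ : fin_supp coef }.

HB.instance Definition _ := [isSub for coef].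
HB.instance Definition _ := [Choice of laurent by <:].
HB.instance Definition _ := [SubChoice_isSubLmodule of laurent by <:].

Lemma laurent_finite (a : laurent) : finite_set (supp a).
Proof. by case: a => f f_fin; apply/asboolP. Qed.

Lemma laurentP (a b : laurent) : (forall i, a i = b i) -> a = b.
Proof. by move=> ab; apply: val_inj; apply/funext. Qed.

Lemma laurentE c (a b : laurent) i : (c *: a + b) i = c *: a i + b i.
Proof. by []. Qed.

Lemma laurentD (a b : laurent) i : (a + b) i = a i + b i.
Proof. by []. Qed.

Lemma mono_subproof (i : Zn) (v : V) :
  fin_supp (fun j => if j == i then v else 0).
Proof.
apply/asboolP; apply: sub_finite_set (finite_set1 i) => j; rewrite /supp /=.
by case: ifP => [/eqP -> //|_]; rewrite eqxx.
Qed.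

Definition mono i v : laurent := Laurent (mono_subproof i v).

Lemma monoE i v j : mono i v j = if j == i then v else 0.
Proof. by []. Qed.

Lemma mono_linear i : linear (mono i).
Proof.
move=> c u v; apply/laurentP => j; rewrite laurentE !monoE.
by case: ifP => // _; rewrite scaler0 addr0.
Qed.

HB.instance Definition _ i :=
  GRing.isLinear.Build K V laurent *:%R (mono i) (mono_linear i).

Lemma laurent_sum (a : laurent) : a = \sum_(i \in supp a) mono i (a i).
Proof.
apply/laurentP => j.
have ev_add : {morph (fun b : laurent => b j) : x y / x + y} by [].
rewrite fsbig_finite /=; last exact: laurent_finite.
rewrite (big_morph (fun b : laurent => b j) (id1 := 0) (op1 := +%R)) //=.
have [aj|aj] := eqVneq (a j) 0.
  rewrite big1 // => i _; case: eqP => // <- //.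
rewrite (big_fsetD1 j) /=; last first.
  by rewrite in_fset_set ?inE //; apply: laurent_finite.
rewrite eqxx big1_fset ?addr0 // => i; rewrite !inE.
by move=> /andP[/negPf]; rewrite eq_sym => ->.
Qed.

End FiniteSupport.

(* The linear map sending v (x) t^i to f i v. *)
Definition lext (K : nzRingType) (n : nat) (V W : lmodType K)
    (f : 'rV[int]_n.+1 -> V -> W) (a : laurent n V) : W :=
  \sum_(i \in supp a) f i (a i).

Section LinearExtension.
Variables (K : nzRingType) (n : nat) (V W : lmodType K).
Local Notation Zn := 'rV[int]_n.+1.
Implicit Types (f : Zn -> V -> W) (a b : laurent n V).

Lemma linear_map0 (f : V -> W) : linear f -> f 0 = 0.
Proof.
by move=> /(_ (-1) 0 0); rewrite scaler0 addr0 scaleN1r addNr => ->.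
Qed.

Lemma linear_mapD (f : V -> W) : linear f -> {morph f : x y / x + y}.
Proof. by move=> fl x y; rewrite -[x in LHS]scale1r fl scale1r. Qed.

Lemma linear_mapZ (f : V -> W) : linear f -> forall c, {morph f : x / c *: x}.
Proof. by move=> fl c x; rewrite -[_ *: x]addr0 fl linear_map0 ?addr0. Qed.

Lemma lext_widen f a (S : set Zn) : (forall i, f i 0 = 0) ->
  finite_set S -> supp a `<=` S -> lext f a = \sum_(i \in S) f i (a i).
Proof.
move=> f0 _ aS; apply: fsbig_widen => // i [_ /=] /negP.
by rewrite negbK => /eqP ->.
Qed.

Lemma lext_linear f : (forall i, linear (f i)) -> linear (lext f).
Proof.
move=> fl c a b; pose S := supp a `|` supp b.
have f0 i : f i 0 = 0 by exact: linear_map0.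
have fS : finite_set S by rewrite finite_setU; split; apply: laurent_finite.
rewrite !(@lext_widen f _ S) //; last 3 first.
- by move=> i; right.
- by move=> i; left.
- move=> i /= abi; apply: contrapT => /not_orP[] /=.
  move=> /negP; rewrite negbK => /eqP ai /negP; rewrite negbK => /eqP bi.
  by move/eqP: abi; apply; rewrite [LHS](laurentE c a b) ai bi scaler0 addr0.
rewrite !fsbig_finite // scaler_sumr -big_split; apply: eq_bigr => i _ /=.
exact: fl.
Qed.

Lemma lext_mono f i v : (forall j, f j 0 = 0) -> lext f (mono i v) = f i v.
Proof.
move=> f0; rewrite (@lext_widen _ _ [set i]) //; last first.
  by move=> j; rewrite /supp /=; case: ifP => [/eqP //|_]; rewrite eqxx.
by rewrite fsbig_set1 /= eqxx.
Qed.

Lemma lext_param (U : lmodType K) (f : U -> Zn -> V -> W) a :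
  (forall i v, linear (fun u => f u i v)) -> linear (fun u => lext (f u) a).
Proof.
move=> fl c u v; rewrite /lext !(fsbig_finite _ _ (laurent_finite a)) scaler_sumr -big_split.
by apply: eq_bigr => i _; rewrite fl.
Qed.

Lemma laurent_ind (P : laurent n V -> Prop) :
  P 0 -> (forall a b, P a -> P b -> P (a + b)) ->
  (forall i v, P (mono i v)) -> forall a, P a.
Proof.
move=> P0 PD Pm a; rewrite [a]laurent_sum fsbig_finite; last exact: laurent_finite.
by elim/big_ind: _ => //= *; apply: Pm.
Qed.

End LinearExtension.

Record lie_bracket (K : nzRingType) (L : lmodType K) (br : L -> L -> L) : Prop :=
  LieBracket {
    lie_linearl : forall y, linear (br^~ y);
    lie_linearr : forall x, linear (br x);
    lie_alternating : forall x, br x x = 0;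
    lie_jacobi : forall x y z,
      br x (br y z) + br y (br z x) + br z (br x y) = 0 }.

Definition simple_lie (K : fieldType) (g : vectType K) (br : g -> g -> g) : Prop :=
  (exists x y, br x y != 0) /\
  forall J : {vspace g}, (forall x y, y \in J -> br x y \in J) ->
    J = 0%VS \/ J = fullv.

Record invariant_form (K : nzRingType) (g : lmodType K) (br : g -> g -> g)
    (form : g -> g -> K) : Prop := InvariantForm {
  form_linearl : forall y, scalar (form^~ y);
  form_linearr : forall x, scalar (form x);
  form_sym : forall x y, form x y = form y x;
  form_nondegenerate : forall x, (forall y, form x y = 0) -> x = 0;
  form_invariant : forall x y z, form (br x y) z = form x (br y z) }.

Record lie_module (K : nzRingType) (L : lmodType K) (br : L -> L -> L)
    (V : lmodType K) (rho : L -> V -> V) : Prop := LieModule {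
  act_linearl : forall v, linear (rho^~ v);
  act_linearr : forall x, linear (rho x);
  act_bracket : forall x y v,
    rho (br x y) v = rho x (rho y v) - rho y (rho x v) }.

Definition submodule (K : nzRingType) (L : lmodType K) (V : lmodType K)
    (rho : L -> V -> V) (U : set V) : Prop :=
  [/\ U 0, forall c u v, U u -> U v -> U (c *: u + v)
    & forall x v, U v -> U (rho x v)].

Definition irreducible_module (K : nzRingType) (L : lmodType K) (V : lmodType K)
    (rho : L -> V -> V) : Prop :=
  (exists v : V, v != 0) /\
  forall U : set V, submodule rho U -> U = [set 0] \/ U = setT.

Section Laurent.
Variables (K : numFieldType) (n : nat).

Local Notation Zn := 'rV[int]_n.+1.
Local Notation Kn := 'rV[K]_n.+1.

Definition zvec (k : Zn) : Kn := map_mx intr k.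

Definition dot (u v : Kn) : K := \sum_i u 0 i * v 0 i.

(* The value on \sum_i u_i d_i of the functional d_i |-> k_i. *)
Definition ev (u : Kn) (k : Zn) : K := \sum_i u 0 i * (k 0 i)%:~R.

(* The bilinear map with (u (x) t^r, v (x) t^s) |-> f r s u v (x) t^(r + s). *)
Definition bext (U V W : lmodType K) (f : Zn -> Zn -> U -> V -> W)
    (a : laurent n U) (b : laurent n V) : laurent n W :=
  lext (fun (r : Zn) u => lext (fun (s : Zn) v => mono (r + s) (f r s u v)) b) a.

(* The free A-module on K_0, ..., K_n, as K^(n+1) (x) A: t^k K_i is
   mono k (delta_mx 0 i). *)
Definition Omega :=
  Eval cbv beta delta [reverse_coercion] in laurent n Kn.

Definition Laur :=
  Eval cbv beta delta [reverse_coercion] in laurent n K^o.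

Definition dform (a : Laur) : Omega :=
  lext (fun (k : Zn) (c : K^o) => mono k ((c : K) *: zvec k)) a.

Definition exact : {pred Omega} := fun w => `[< exists a, w = dform a >].

Lemma dform_linear : linear dform.
Proof.
by apply: lext_linear => k c x y; rewrite scalerDl -scalerA linearP.
Qed.

Lemma exact_submod : submod_closed exact.
Proof.
split=> [|c u v /asboolP[a ->] /asboolP[b ->]]; apply/asboolP.
  by exists 0; rewrite linear_map0 //; apply: dform_linear.
by exists (c *: a + b); rewrite dform_linear.
Qed.

HB.instance Definition _ := GRing.isSubmodClosed.Build K Omega exact exact_submod.

Definition Zquot := Quotient.quot exact.
HB.instance Definition _ := GRing.Zmodule.on Zquot.

Definition Zpi (w : Omega) : Zquot := \pi_(Quotient.quot exact)%qT w.

Lemma Zpi_eq (u v : Omega) : (Zpi u = Zpi v) <-> u - v \in exact.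
Proof. by split=> [/eqP|H]; [|apply/eqP]; rewrite -Quotient.idealrBE. Qed.

Lemma Zpi_repr z : Zpi (repr (z : Quotient.quot exact)) = z.
Proof. exact: reprK. Qed.

Lemma Zpi_D : {morph Zpi : u v / u + v}.
Proof. exact: raddfD. Qed.

Definition Zscale (c : K) (z : Zquot) : Zquot :=
  Zpi (c *: repr (z : Quotient.quot exact)).

Lemma Zpi_Z c : {morph Zpi : u / c *: u >-> Zscale c u}.
Proof.
move=> u; apply/esym/Zpi_eq; rewrite -scalerBr; apply: rpredZ.
by apply/Zpi_eq; rewrite Zpi_repr.
Qed.

Fact Zscale_subproof1 a b v : Zscale a (Zscale b v) = Zscale (a * b) v.
Proof. by rewrite -[v]Zpi_repr -!Zpi_Z scalerA. Qed.

Fact Zscale_subproof2 : left_id 1 Zscale.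
Proof. by move=> v; rewrite -[v]Zpi_repr -Zpi_Z scale1r. Qed.

Fact Zscale_subproof3 : right_distributive Zscale +%R.
Proof.
by move=> a u v; rewrite -[u]Zpi_repr -[v]Zpi_repr -!Zpi_Z -!Zpi_D -Zpi_Z scalerDr.
Qed.

Fact Zscale_subproof4 v : {morph Zscale^~ v : a b / a + b}.
Proof. by move=> a b; rewrite -[v]Zpi_repr -!Zpi_Z -Zpi_D scalerDl. Qed.

HB.instance Definition _ := GRing.Zmodule_isLmodule.Build K Zquot
  Zscale_subproof1 Zscale_subproof2 Zscale_subproof3 Zscale_subproof4.

Lemma Zpi_linear : linear Zpi.
Proof. by move=> c u v; rewrite Zpi_D Zpi_Z. Qed.

HB.instance Definition _ := GRing.isLinear.Build K Omega Zquot *:%R Zpi Zpi_linear.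

Lemma Zpi_ind (P : Zquot -> Prop) : (forall w, P (Zpi w)) -> forall z, P z.
Proof. by move=> Pw z; rewrite -[z]Zpi_repr. Qed.

Definition tK (k : Zn) (i : 'I_n.+1) : Zquot := Zpi (mono k (delta_mx 0 i)).

(* W_(n+1), as K^(n+1) (x) A. *)
Definition Witt :=
  Eval cbv beta delta [reverse_coercion] in laurent n Kn.

Definition td (r : Zn) (i : 'I_n.+1) : Witt := mono r (delta_mx 0 i).

Definition Witt_br : Witt -> Witt -> Witt :=
  bext (fun r s u v => ev u s *: v - ev v r *: u).

(* The action of vector fields on 1-forms. *)
Definition Witt_Omega : Witt -> Omega -> Omega :=
  bext (fun r s u v => ev u s *: v + dot u v *: zvec r).

Definition Witt_Z (w : Witt) (z : Zquot) : Zquot :=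
  Zpi (Witt_Omega w (repr (z : Quotient.quot exact))).

Definition phi1 (w w' : Witt) : Zquot :=
  Zpi (bext (fun r s u v => - (ev u s * ev v r) *: zvec r) w w').

Definition phi2 (w w' : Witt) : Zquot :=
  Zpi (bext (fun r s u v => (ev u r * ev v s) *: zvec r) w w').

Definition phi (c1 c2 : K) (w w' : Witt) : Zquot :=
  c1 *: phi1 w w' + c2 *: phi2 w w'.

Definition vir := (Zquot * Witt)%type.
HB.instance Definition _ := GRing.Lmodule.on vir.

Definition vir_br (c1 c2 : K) (x y : vir) : vir :=
  (Witt_Z x.2 y.1 - Witt_Z y.2 x.1 + phi c1 c2 x.2 y.2,
   Witt_br x.2 y.2).

Definition vir_Z (z : Zquot) : vir := (z, 0).
Definition vir_W (w : Witt) : vir := (0, w).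

Section Toroidal.
Variables (g : vectType K) (br : g -> g -> g) (form : g -> g -> K) (c1 c2 : K).

Definition loop_br : laurent n g -> laurent n g -> laurent n g :=
  bext (fun _ _ => br).

Definition loop_cocycle (x y : laurent n g) : Zquot :=
  Zpi (bext (fun k _ u v => form u v *: zvec k) x y).

Definition Witt_loop : Witt -> laurent n g -> laurent n g :=
  bext (fun r s u x => ev u s *: x).

Definition toroidal := (laurent n g * vir)%type.
HB.instance Definition _ := GRing.Lmodule.on toroidal.

Definition tor_vir (x : vir) : toroidal := (0, x).

Definition tor_br (x y : toroidal) : toroidal :=
  (loop_br x.1 y.1 + Witt_loop x.2.2 y.1 - Witt_loop y.2.2 x.1,
   vir_Z (loop_cocycle x.1 y.1) + vir_br c1 c2 x.2 y.2).

End Toroidal.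

(* In what follows dact i is the action of d_i on V. *)
Section HarishChandra.
Variables (V : lmodType K) (dact : 'I_n.+1 -> V -> V).

Definition weight_space (mu : Kn) : set V :=
  [set v | forall i, dact i v = mu 0 i *: v].

Definition dim_le (N : nat) (U : set V) : Prop :=
  exists b : N.-tuple V, (forall j, U (tnth b j)) /\
    forall v, U v -> exists c : 'I_N -> K, v = \sum_j c j *: tnth b j.

(* V is the internal direct sum of the subspaces U m. *)
Definition direct_sum (U : Zn -> set V) : Prop :=
  forall v, exists! a : laurent n V,
    (forall m, U m (a m)) /\ v = \sum_(m \in supp a) a m.

Definition Harish_Chandra_at (lam : Kn) : Prop :=
  direct_sum (fun m => weight_space (lam + zvec m)) /\
  forall m, exists N, dim_le N (weight_space (lam + zvec m)).

Definition Harish_Chandra : Prop := exists lam, Harish_Chandra_at lam.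

Definition cuspidal : Prop :=
  exists lam, Harish_Chandra_at lam /\
    exists N0, forall m, dim_le N0 (weight_space (lam + zvec m)).

End HarishChandra.

End Laurent.

(* Main.v *)
From HB Require Import structures.
Require Import Defs.
From mathcomp Require Import all_boot all_order all_algebra.
From mathcomp Require Import complex.
From mathcomp Require Import boolp classical_sets functions fsbigop.
From mathcomp Require Import reals.
From mathcomp Require Import ring.

(** Write K(v, k) for the class of t^k sum_i v_i K_i ([KZ]), so that
K(k, k) = 0, and D(u, r) for t^r sum_i u_i d_i; vector fields act on these
classes by [D(u, r), K(v, s)] = K((u.s) v + (u.v) r, r + s). The same argument
serves both Lie algebras: all it uses of the algebra L acting on V is that it
contains the fields D(u, r), acting in this way, and that the space Z of the
K(v, k) is an abelian ideal of L.
Let A be a commutative algebra of operators on V that contains those of Z and is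
stable under all derivations ad x, x in L; the bicommutant of Z is one.

For f in A, the vectors killed by a power of f form an L-submodule of V, because
ad x (f^(m+1)) is divisible by f^m. If f has degree 0, it has an eigenvalue c on
some weight space, so irreducibility makes f - c locally nilpotent, and then
the bound on the dimensions of the weight spaces makes it nilpotent
([degree0_nilpotent]).

Nilpotency spreads along derivations. If a^m = 0, then every product of 2m
elements of the form ad x a vanishes, the x being arbitrary and all different if
one likes ([nilpotent_derivation_prod]); in particular each ad x a is nilpotent.
For i != j apply this to f = a a' with a = K(e_i, e_j) and a' = K(e_i, -e_j).
A vector field that kills a, and sends a' to -b where b = K(e_i, e_i - 2 e_j),
shows that a b is nilpotent. Another one, which sends b to -2a, expresses 2 a^3
through a b and its derivative, so a^3 and with it a is nilpotent
([nilpotent_of_pair], [zop_nilpotent]).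

Nilpotency of each single operator of Z would not be enough, because Z is
infinite-dimensional. However, the finitely many nilpotent operators K(e_i, e_0),
i != 0, have the property that their images under L span Z. Each of them allows
only products of bounded length in its derivatives, so a longest nonvanishing
product yields a nonzero vector that all these derivatives kill
([common_kernel_of_nilpotents]). That vector is killed by Z, and the vectors
killed by the ideal Z form a submodule, which is therefore V. *)

Set Implicit Arguments.
Unset Strict Implicit.
Unset Printing Implicit Defensive.
Import GRing.Theory Num.Theory.
Local Open Scope classical_set_scope.
Local Open Scope ring_scope.

(** * Nilpotent elements and derivations *)

Definition nilpotent (A : pzRingType) (a : A) : Prop := exists m, a ^+ m = 0.

Section Nilpotent.
Variable A : comPzRingType.
Implicit Types a b : A.

Lemma expr0_ge a m k : a ^+ m = 0 -> (m <= k)%N -> a ^+ k = 0.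
Proof. by move=> am0 /subnK <-; rewrite exprD am0 mulr0. Qed.

Lemma nilpotentM a b : nilpotent a -> nilpotent (b * a).
Proof. by case=> m am0; exists m; rewrite exprMn am0 mulr0. Qed.

Lemma nilpotentD a b : nilpotent a -> nilpotent b -> nilpotent (a + b).
Proof.
move=> [m am0] [k bk0]; exists (m + k)%N; rewrite exprDn big1 // => i _.
have [mi|im] := leqP m (m + k - i)%N.
  by rewrite (expr0_ge am0 mi) mul0r mul0rn.
rewrite (@expr0_ge b k) ?mulr0 ?mul0rn // leqNgt.
by apply: contraL im => ik; rewrite -leqNgt -addnBA ?leq_addr // ltnW.
Qed.

Lemma nilpotentN a : nilpotent a -> nilpotent (- a).
Proof. by move=> /(nilpotentM (-1)); rewrite mulN1r. Qed.

Lemma nilpotentX a k : nilpotent (a ^+ k) -> nilpotent a.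
Proof. by case=> m; rewrite -exprM => akm0; exists (k * m)%N. Qed.

End Nilpotent.

Record derivation (A : pzRingType) (d : A -> A) : Prop := Derivation {
  derivationD : {morph d : a b / a + b};
  derivationM : forall a b, d (a * b) = d a * b + a * d b }.

Section DerivationTheory.
Variables (A : comPzRingType) (I : Type) (d : I -> A -> A).
Hypothesis d_der : forall i, derivation (d i).
Hypothesis A_torsion_free : forall (a : A) k, a *+ k.+1 = 0 -> a = 0.
Implicit Types a b c : A.

Lemma derivation0 i : d i 0 = 0.
Proof.
by apply: (addrI (d i 0)); rewrite -(derivationD (d_der i)) !addr0.
Qed.

Lemma derivationN i a : d i (- a) = - d i a.
Proof.
by apply/eqP; rewrite -addr_eq0 -(derivationD (d_der i)) addNr derivation0.
Qed.

Lemma derivation1 i : d i 1 = 0.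
Proof.
apply: (addrI (d i 1)).
by rewrite addr0 -{3}[1]mul1r (derivationM (d_der i)) mulr1 mul1r.
Qed.

Lemma derivationX i a k : d i (a ^+ k.+1) = (a ^+ k * d i a) *+ k.+1.
Proof.
elim: k => [|k IH]; first by rewrite expr0 mul1r expr1.
rewrite exprS (derivationM (d_der i)) IH mulrnAr mulrA -exprS mulrC.
by rewrite [RHS]mulrS.
Qed.

(** Expanding the derivative of the product, each summand loses one factor of
the form [d k a]; the extra factor [d j a] replaces it, so that [c] is again
multiplied by a product of the same length. *)
Lemma mul_derivation_prod c (a : A) (i j : I) (s : seq I) :
  (forall s', size s' = size s -> c * \prod_(k <- s') d k a = 0) ->
  c * d i (\prod_(k <- s) d k a) * d j a = 0.
Proof.
elim: s c => [|k s IH] c cs0; first by rewrite big_nil derivation1 mulr0 mul0r.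
rewrite big_cons (derivationM (d_der i)) mulrDr mulrDl.
rewrite [X in X + _](_ : _ = c * \prod_(l <- j :: s) d l a * d i (d k a)).
  rewrite cs0 // mul0r add0r mulrA IH // => s' ss'.
  by rewrite -mulrA -[RHS](cs0 (k :: s')) ?big_cons //= ss'.
by rewrite big_cons; ring.
Qed.

(** By induction on k, a^(m-k) kills all products of 2k derivatives of [a]:
deriving such a relation trades one factor [a] for a derivative, and one further
derivative removes the other terms. Since the derivations may differ from
factor to factor, this says more than the nilpotency of each [d i a]. *)
Lemma nilpotent_derivation_prod a m (s : seq I) :
  a ^+ m = 0 -> size s = m.*2 -> \prod_(i <- s) d i a = 0.
Proof.
move=> am0.
suff H k p t : (k + p = m)%N -> size t = k.*2 ->
    a ^+ p * \prod_(i <- t) d i a = 0.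
  move=> ss; have := H m 0%N s (addn0 m) ss.
  by rewrite expr0 mul1r.
elim: k p t => [|k IH] p t.
  by rewrite add0n => ->; case: t => //; rewrite am0 mul0r.
case: t => [//|i [//|j t]] kp /= [] tk.
apply: (@A_torsion_free _ p).
have kp' : (k + p.+1 = m)%N by rewrite addnS -addSn.
have := congr1 (fun b => d i b * d j a) (IH p.+1 t kp' tk).
rewrite (derivationM (d_der i)) derivation0 mul0r mulrDl derivationX.
rewrite (mul_derivation_prod (c := a ^+ p.+1)) ?addr0; last first.
  by move=> s' ss'; apply: IH; rewrite ?ss'.
by move=> <-; rewrite !big_cons !mulrnAl; congr (_ *+ _); ring.
Qed.

Lemma nilpotent_derivation i a : nilpotent a -> nilpotent (d i a).
Proof.
case=> m am0; exists m.*2.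
have := @nilpotent_derivation_prod a m (nseq m.*2 i) am0 (size_nseq _ _).
by rewrite big_nseq -[iter _ _ _]/(iter _ ( *%R (d i a)) _) iter_mulr_1.
Qed.

(** The scheme by which the relations between one-forms enter: deriving
[a * a' - c] along [d i] gives [- (a * b)], and 2 a^3 is the combination
[d j a * (a * b) - a * d j (a * b)] of [a * b] and its derivative. *)
Lemma nilpotent_of_pair i j a a' b c :
  nilpotent (a * a' - c) -> d i c = 0 -> d i a = 0 -> d i a' = - b ->
  d j b = - (a *+ 2) -> nilpotent a.
Proof.
move=> nil dc da da' db.
have nab : nilpotent (a * b).
  have /nilpotentN := nilpotent_derivation i nil.
  rewrite (derivationD (d_der i)) (derivationM (d_der i)) derivationN.
  by rewrite dc da da' mul0r add0r subr0 mulrN opprK.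
have n2a3 : nilpotent (a ^+ 3 *+ 2).
  have -> : a ^+ 3 *+ 2 = d j a * (a * b) + (- a) * d j (a * b).
    rewrite (derivationM (d_der j)) db; ring.
  apply: nilpotentD; first exact: nilpotentM.
  exact/nilpotentM/nilpotent_derivation.
case: n2a3 => m a3m0; apply: (nilpotentX (k := 3)); exists m.
move: a3m0; rewrite exprMn_n; case: (2 ^ m)%N (expn_gt0 2 m) => // k _.
exact: A_torsion_free.
Qed.

End DerivationTheory.

(** * The bicommutant of a commuting family of operators *)

Lemma linear_mapN (K : nzRingType) (V W : lmodType K) (f : V -> W) :
  linear f -> {morph f : u / - u}.
Proof. by move=> fl u; rewrite -scaleN1r (linear_mapZ fl) scaleN1r. Qed.

Lemma linear_mapB (K : nzRingType) (V W : lmodType K) (f : V -> W) :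
  linear f -> {morph f : u v / u - v}.
Proof. by move=> fl u v; rewrite (linear_mapD fl) (linear_mapN fl). Qed.

Section Bicommutant.
Variables (K : comNzRingType) (V : lmodType K).
Implicit Types (S : set (V -> V)) (f g : V -> V).

Definition commutant S : set (V -> V) :=
  [set f | linear f /\ forall s v, S s -> f (s v) = s (f v)].

Definition bicommuting S : {pred (V -> V)} :=
  fun f => `[< commutant (commutant S) f >].

Lemma bicommuting_submod S : submod_closed (bicommuting S).
Proof.
split=> [|c f g /asboolP[fl fc] /asboolP[gl gc]]; apply/asboolP; split.
- by move=> c u v /=; rewrite [LHS](erefl 0) [RHS](erefl (c *: 0 + 0)) scaler0 addr0.
- by move=> s v [/linear_map0 s0 _]; rewrite [RHS](_ : _ = s 0) ?s0.
- move=> k u v; rewrite -[LHS]/(c *: f _ + g _) fl gl.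
  rewrite -[RHS]/(k *: (c *: f u + g u) + (c *: f v + g v)).
  by rewrite !scalerDr !scalerA (mulrC c) addrACA.
- move=> s v /[dup] [[sl _]] sS.
  rewrite -[LHS]/(c *: f _ + g _) fc // gc //.
  by rewrite -[RHS]/(s (c *: f v + g v)) sl.
Qed.

HB.instance Definition _ S :=
  GRing.isSubmodClosed.Build K (V -> V) (bicommuting S) (bicommuting_submod S).

(** The commutant inherits stability under the commutator with [x]; used twice,
this gives the bicommutant the derivation [adjoint]. *)
Lemma commutant_commutator S f (x : V -> V) :
  linear x -> (forall s, S s -> linear s) ->
  (forall s, S s -> S (fun v => x (s v) - s (x v))) ->
  commutant S f -> commutant S (fun v => x (f v) - f (x v)).
Proof.
move=> xl Sl xS [fl fc]; split=> [c u v|s v Ss].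
  by rewrite fl !xl fl scalerBr opprD addrACA.
have := fc _ v (xS s Ss); rewrite (linear_mapB fl) (fc s (x v) Ss) => fxs.
rewrite (fc s v Ss) (linear_mapB (Sl s Ss)).
rewrite -[x (s (f v))](subrK (s (x (f v)))) -fxs addrAC.
by rewrite (addrAC (f _)) subrr sub0r addrC.
Qed.

Section Algebra.
Variables (S : set (V -> V)) (S_comm : S `<=` commutant S).

(** The hypothesis on [S] is a parameter of the type because multiplication
commutes only when [S] does: the bicommutant is then contained in the commutant,
with which it commutes. Taking the bicommutant, and not the algebra generated
by [S], makes stability under commutators a formal consequence. *)
Record bicommutant (commS : S `<=` commutant S) := Bicommutant {
  bicomm_fun :> V -> V; _ : bicommuting S bicomm_fun }.

Local Notation A := (bicommutant S_comm).

HB.instance Definition _ := [isSub for @bicomm_fun S_comm].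
HB.instance Definition _ := [Choice of A by <:].
HB.instance Definition _ := [SubChoice_isSubLmodule of A by <:].

Implicit Types a b : A.

Lemma bicommutantP a : commutant (commutant S) a.
Proof. exact/asboolP/(valP a). Qed.

Lemma bicomm_ext a b : (forall v, a v = b v) -> a = b.
Proof. by move=> ab; apply/val_inj/funext. Qed.

Lemma bicomm_linear a : linear a.
Proof. by have [] := bicommutantP a. Qed.

Lemma bicommutant_sub : commutant (commutant S) `<=` commutant S.
Proof.
move=> f [fl fc]; split=> // s v /S_comm sc.
exact: fc.
Qed.

Lemma bicommC a b v : a (b v) = b (a v).
Proof.
have [_ ac] := bicommutantP a.
by rewrite ac //; apply/bicommutant_sub/bicommutantP.
Qed.

Fact bicomm_one_subproof : bicommuting S id.
Proof. by apply/asboolP. Qed.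

Fact bicomm_mul_subproof a b : bicommuting S (a \o b).
Proof.
have [al ac] := bicommutantP a; have [bl bc] := bicommutantP b.
apply/asboolP; split=> [c u v|s v sc] /=; first by rewrite bl al.
by rewrite bc // ac.
Qed.

Definition bicomm_one : A := Bicommutant _ bicomm_one_subproof.
Definition bicomm_mul a b : A := Bicommutant _ (bicomm_mul_subproof a b).

Fact bicomm_mulA : associative bicomm_mul.
Proof. by move=> a b c; apply: bicomm_ext. Qed.

Fact bicomm_mulC : commutative bicomm_mul.
Proof. by move=> a b; apply: bicomm_ext => v; apply: bicommC. Qed.

Fact bicomm_mul1 : left_id bicomm_one bicomm_mul.
Proof. by move=> a; apply: bicomm_ext. Qed.

Fact bicomm_mulDl : left_distributive bicomm_mul +%R.
Proof. by move=> a b c; apply: bicomm_ext. Qed.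

HB.instance Definition _ := GRing.Zmodule_isComPzRing.Build A
  bicomm_mulA bicomm_mulC bicomm_mul1 bicomm_mulDl.

Lemma bicommM a b v : (a * b) v = a (b v). Proof. by []. Qed.
Lemma bicomm1 v : (1 : A) v = v. Proof. by []. Qed.
Lemma bicomm0 v : (0 : A) v = 0. Proof. by []. Qed.
Lemma bicommD a b v : (a + b) v = a v + b v. Proof. by []. Qed.
Lemma bicommN a v : (- a) v = - a v. Proof. by []. Qed.
Lemma bicommZ c a v : (c *: a) v = c *: a v. Proof. by []. Qed.

Lemma bicomm_scaleAl c a b : (c *: a) * b = c *: (a * b).
Proof. exact: bicomm_ext. Qed.

Lemma bicomm_scaleAr c a b : a * (c *: b) = c *: (a * b).
Proof. by rewrite mulrC bicomm_scaleAl mulrC. Qed.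

Lemma bicomm_gen_subproof s : S s -> bicommuting S s.
Proof.
move=> Ss; have [sl _] := S_comm Ss.
by apply/asboolP; split=> // f v [_ fc]; rewrite fc.
Qed.

Definition bicomm_gen s (Ss : S s) : A := Bicommutant _ (bicomm_gen_subproof Ss).

Section Adjoint.
Variables (x : V -> V) (x_lin : linear x).
Hypothesis xS : forall s, S s -> S (fun v => x (s v) - s (x v)).

Fact adjoint_subproof a : bicommuting S (fun v => x (a v) - a (x v)).
Proof.
apply/asboolP; apply: commutant_commutator (bicommutantP a) => //.
  by move=> f [].
move=> f fc; apply: commutant_commutator fc => // s Ss.
by have [] := S_comm Ss.
Qed.

Definition adjoint a : A := Bicommutant _ (adjoint_subproof a).

Lemma adjointE a v : adjoint a v = x (a v) - a (x v). Proof. by []. Qed.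

Lemma adjoint_derivation : derivation adjoint.
Proof.
split=> a b; apply: bicomm_ext => v; rewrite ?(bicommD, bicommM) !adjointE.
  by rewrite !bicommD (linear_mapD x_lin) opprD addrACA.
by rewrite (linear_mapB (bicomm_linear a)) addrA subrK.
Qed.

Lemma adjointZ c a : adjoint (c *: a) = c *: adjoint a.
Proof.
apply: bicomm_ext => v.
by rewrite bicommZ !adjointE !bicommZ (linear_mapZ x_lin) scalerBr.
Qed.

End Adjoint.
End Algebra.
End Bicommutant.

(** * Locally finite operators *)

Section LocallyFinite.
Variables (K : fieldType) (V : lmodType K) (f : V -> V).
Hypothesis f_lin : linear f.
Implicit Types (p : {poly K}) (v : V).

(** The operator p(f), applied to [v]. *)
Definition poly_act (p : {poly K}) (v : V) : V :=
  \sum_(i < size p) p`_i *: iter i f v.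

Lemma poly_act_widen p k v : (size p <= k)%N ->
  poly_act p v = \sum_(i < k) p`_i *: iter i f v.
Proof.
move=> pk; rewrite /poly_act (big_ord_widen k (fun i => p`_i *: iter i f v)) //.
rewrite big_mkcond; apply: eq_bigr => i _.
by case: ltnP => // /(nth_default 0) ->; rewrite scale0r.
Qed.

Lemma poly_act_XsubC a p v :
  poly_act (('X - a%:P) * p) v = f (poly_act p v) - a *: poly_act p v.
Proof.
have sp : (size (('X - a%:P) * p)%R <= (size p).+1)%N.
  by apply: leq_trans (size_polyMleq _ _) _; rewrite size_XsubC.
rewrite (poly_act_widen _ sp).
under eq_bigr => i _ do rewrite mulrBl coefB coefXM coefCM scalerBl.
rewrite sumrB big_ord_recl scale0r add0r; congr (_ - _).
  rewrite /poly_act (big_morph f (linear_mapD f_lin) (linear_map0 f_lin)).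
  by apply: eq_bigr => i _; rewrite (linear_mapZ f_lin).
rewrite (poly_act_widen _ (leqnSn _)) scaler_sumr.
by apply: eq_bigr => i _; rewrite scalerA.
Qed.

End LocallyFinite.

(** Apply the linear factors of [p] to [v] one after the other; the last nonzero
vector before reaching 0 is an eigenvector. *)
Lemma eigenvector_of_annihilator (K : closedFieldType) (V : lmodType K)
    (f : V -> V) (p : {poly K}) (v : V) :
  linear f -> v != 0 -> p != 0 -> poly_act f p v = 0 ->
  exists c w, w != 0 /\ f w = c *: w.
Proof.
move=> fl v0 p0; have [r pr] := closed_field_poly_normal p.
have lc0 : lead_coef p != 0 by rewrite lead_coef_eq0.
have pE : poly_act f p v =
    lead_coef p *: poly_act f (\prod_(z <- r) ('X - z%:P)) v.
  rewrite {1}pr /poly_act scaler_sumr size_scale //.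
  by apply: eq_bigr => i _; rewrite coefZ scalerA.
rewrite pE => /eqP; rewrite scaler_eq0 (negPf lc0) /= => /eqP.
elim: r {pr pE} => [|z r IH].
  rewrite big_nil /poly_act size_poly1 big_ord1 coef1 scale1r /=.
  by move=> v00; rewrite v00 eqxx in v0.
rewrite big_cons poly_act_XsubC //.
have [/IH //|w0 /eqP] := eqVneq (poly_act f (\prod_(z <- r) ('X - z%:P)) v) 0.
by rewrite subr_eq0 => /eqP fw; exists z; eexists; split; first exact: w0.
Qed.

(** The coordinates of [N.+1] vectors on a spanning family of size [N] form a
matrix with more rows than columns, which has a nonzero left kernel. *)
Lemma dim_le_dependent (K : numFieldType) (V : lmodType K) N (U : set V)
    (u : nat -> V) :
  dim_le N U -> (forall i, U (u i)) ->
  exists c : nat -> K, (exists2 i, (i <= N)%N & c i != 0) /\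
    \sum_(i < N.+1) c i *: u i = 0.
Proof.
move=> [b [_ bU]] Uu.
have /choice[M uM] : forall i, exists c : 'I_N -> K,
    u i = \sum_j c j *: tnth b j by move=> i; exact: bU (Uu i).
pose B := \matrix_(i < N.+1, j < N) M i j.
have : kermx B != 0.
  rewrite kermx_eq0 /row_free; apply/negP => /eqP rB.
  by have := rank_leq_col B; rewrite rB ltnn.
move=> /rowV0Pn[y /sub_kermxP yB y0].
have [i yi] : exists i, y 0 i != 0.
  apply: contrapT => /forallNP y00; case/eqP: y0; apply/rowP => i.
  by rewrite mxE; apply/eqP/negP => yi; apply: (y00 i); apply/negP.
exists (fun i => y 0 (inord i)); split.
  by exists i; rewrite ?inord_val // -ltnS.
under eq_bigr => k _ do rewrite inord_val uM scaler_sumr.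
rewrite exchange_big big1 //= => j _.
under eq_bigr => k _ do rewrite scalerA.
have yMj : \sum_(k < N.+1) y 0 k * M k j = 0.
  have /rowP/(_ j) := yB; rewrite !mxE => yBj; rewrite -[RHS]yBj.
  by apply: eq_bigr => k _; rewrite mxE.
by rewrite -scaler_suml yMj scale0r.
Qed.

(** The point is that [N] does not depend on [v]. In a linear relation between
[v], ..., g^N v, let i be the least exponent that occurs; applying g^(m-1-i)
when g^m v = 0 leaves only the term g^(m-1) v. *)
Lemma locally_nilpotent_bound (K : numFieldType) (V : lmodType K) N (U : set V)
    (g : V -> V) (v : V) m :
  linear g -> dim_le N U -> (forall w, U w -> U (g w)) -> U v ->
  iter m g v = 0 -> iter N g v = 0.
Proof.
move=> gl dU Ug Uv gm0.
have gi0 i : iter i g 0 = 0 by elim: i => //= i ->; rewrite linear_map0.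
have Ui i : U (iter i g v) by elim: i => //= i; apply: Ug.
have [c [/cid2[i0 i0N ci0] sum0]] := dim_le_dependent dU Ui.
pose P i := c i != 0.
have exP : exists i, P i by exists i0.
case: (ex_minnP exP) => i ci imin {exP}.
have iN : (i <= N)%N by apply: leq_trans (imin _ ci0) i0N.
elim: m gm0 => [|m IH]; first by rewrite /= => ->; rewrite gi0.
have [Nm|mN] := leqP N m; last first.
  by move=> gm0; rewrite -(subnK mN) iterD gm0 gi0.
move=> gm0; apply: IH.
have gD k : {morph iter k g : u w / u + w}.
  by elim: k => // k IH u w; rewrite !iterS IH (linear_mapD gl).
have gZ k a : {morph iter k g : u / a *: u}.
  by elim: k => // k IH u; rewrite !iterS IH (linear_mapZ gl).
have := congr1 (iter (m - i) g) sum0.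
rewrite (big_morph _ (gD _) (gi0 _)) gi0.
rewrite (bigD1 (inord i)) //= inordK ?ltnS // big1 => [|k].
  rewrite addr0 gZ -iterD subnK ?(leq_trans iN) // => /eqP.
  by rewrite scaler_eq0 => /orP[/idPn//|/eqP].
rewrite -val_eqE /= inordK ?ltnS // => ki; rewrite gZ.
have [cik|] := ltnP k i.
  have -> : c k = 0 by apply/eqP/negPn/negP => /imin; rewrite leqNgt cik.
  by rewrite scale0r.
rewrite leq_eqVlt eq_sym (negPf ki) /= => ik.
rewrite -iterD [iter _ g v](_ : _ = 0) ?scaler0 //.
rewrite -(subnK (_ : m.+1 <= m - i + k)%N) ?iterD ?gm0 ?gi0 //.
by rewrite addnC addnBA ?(leq_trans iN) // ltn_subRL ltn_add2r.
Qed.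

(** * An abelian ideal acting on an irreducible module *)

Lemma irreducible_submodule (K : nzRingType) (L V : lmodType K)
    (rho : L -> V -> V) (U : set V) (v : V) :
  irreducible_module rho -> submodule rho U -> U v -> v != 0 -> forall w, U w.
Proof.
move=> [_ irr] /irr[U0|UT] Uv v0 w; last by rewrite UT.
by move: Uv v0; rewrite U0 /= => ->; rewrite eqxx.
Qed.

Section AbelianIdeal.
Variables (K : numFieldType) (L : lmodType K) (br : L -> L -> L).
Variables (V : lmodType K) (rho : L -> V -> V).
Hypotheses (rho_mod : lie_module br rho) (rho_irr : irreducible_module rho).
Variables (Z : lmodType K) (zeta : Z -> L).
Hypothesis zeta_abelian : forall z z', br (zeta z) (zeta z') = 0.
Hypothesis zeta_ideal : forall x z, exists z', br x (zeta z) = zeta z'.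

Definition ideal_ops : set (V -> V) := range (rho \o zeta).

Let rho_lin x : linear (rho x) := act_linearr rho_mod x.

Lemma rho0 v : rho 0 v = 0.
Proof. exact: linear_map0 (act_linearl rho_mod v). Qed.

Lemma ideal_ops_comm : ideal_ops `<=` commutant ideal_ops.
Proof.
move=> _ [z _ <-]; split=> [|_ v [z' _ <-] /=]; first exact: rho_lin.
apply/eqP; rewrite -subr_eq0 -(act_bracket rho_mod) zeta_abelian.
by rewrite rho0.
Qed.

Local Notation A := (bicommutant ideal_ops_comm).

Lemma ideal_ops_stable x s : ideal_ops s ->
  ideal_ops (fun v => rho x (s v) - s (rho x v)).
Proof.
move=> [z _ <-]; have [z' xz] := zeta_ideal x z; exists z' => //.
by apply/funext => v /=; rewrite -xz (act_bracket rho_mod).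
Qed.

Definition ad x : A -> A := adjoint (rho_lin x) (@ideal_ops_stable x).

Lemma adE x (a : A) v : ad x a v = rho x (a v) - a (rho x v).
Proof. by []. Qed.

Lemma ad_derivation x : derivation (ad x).
Proof. exact: adjoint_derivation. Qed.

Lemma adZ x c a : ad x (c *: a) = c *: ad x a.
Proof. exact: adjointZ. Qed.

Definition ideal_op z : A :=
  bicomm_gen ideal_ops_comm (imageT (rho \o zeta) z).

Lemma ideal_opE z v : ideal_op z v = rho (zeta z) v. Proof. by []. Qed.

Lemma ad_ideal_op x z z' : br x (zeta z) = zeta z' ->
  ad x (ideal_op z) = ideal_op z'.
Proof.
move=> xz; apply: bicomm_ext => v.
by rewrite adE !ideal_opE -xz (act_bracket rho_mod).
Qed.

Lemma bicomm_torsion_free (a : A) k : a *+ k.+1 = 0 -> a = 0.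
Proof.
move=> /eqP; rewrite -scaler_nat scaler_eq0 pnatr_eq0 /=.
by move/eqP.
Qed.

(** The vectors killed by some power of [g] form a submodule: for x in L, the
commutator of x with g^(m+1) is a multiple of g^m, as the operators commute with
their derivatives. *)
Lemma generalized_kernel_full (g : A) v :
  v != 0 -> g v = 0 -> forall w, exists m, (g ^+ m) w = 0.
Proof.
move=> v0 gv; pose U w := exists m, (g ^+ m) w = 0.
have a0 (a : A) : a 0 = 0 by exact: linear_map0 (bicomm_linear a).
apply: (@irreducible_submodule _ _ _ rho U v) => //; last by exists 1%N.
split=> [|c u w [m gu] [k gw]|x w [m gw]].
- by exists 0%N.
- exists (m + k)%N; rewrite bicomm_linear exprD !bicommM gw.
  by rewrite bicommC gu !a0 scaler0 addr0.
- exists m.+1; have := adE x (g ^+ m.+1) w.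
  rewrite (derivationX ad_derivation) -scaler_nat bicommZ mulrC bicommM gw a0.
  rewrite scaler0 exprS bicommM gw a0 (linear_map0 (rho_lin x)).
  by move=> /esym/eqP; rewrite sub0r oppr_eq0 => /eqP.
Qed.

(** Treating the operators one at a time, multiply a vector already found for the
others by derivatives of [a] for as long as the result is nonzero. This stops,
as the products of derivatives of [a] of a given length all vanish, and it does
not spoil the earlier conditions, as all operators in question commute. *)
Lemma common_kernel_of_nilpotents (s : seq A) :
  (forall a, a \in s -> nilpotent a) ->
  exists v, v != 0 /\ forall a x, a \in s -> ad x a v = 0.
Proof.
have a0 (a : A) : a 0 = 0 by exact: linear_map0 (bicomm_linear a).
elim: s => [_|a s IH nil]; first by have [[v v0] _] := rho_irr; exists v.
have {IH}[b bs|v [v0 sv]] := IH; first by apply: nil; rewrite inE bs orbT.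
have [m am0] := nil a (mem_head _ _).
suff H k w : w != 0 -> (forall b x, b \in s -> ad x b w = 0) ->
    (forall t, size t = k -> (\prod_(x <- t) ad x a) w = 0) ->
    exists v, v != 0 /\ forall b x, b \in a :: s -> ad x b v = 0.
  apply: (H m.*2 v) => // t st.
  by rewrite (nilpotent_derivation_prod ad_derivation bicomm_torsion_free am0).
elim: k w => [|k IH] w w0 sw tw.
  by have := tw [::] erefl; rewrite big_nil bicomm1 => w00; rewrite w00 eqxx in w0.
have [aw|/existsNP[x /eqP aw]] := pselect (forall x, ad x a w = 0).
  by exists w; split=> // b x; rewrite inE => /orP[/eqP->|]; [apply: aw|apply: sw].
apply: IH aw _ _ => [b y bs|t tk]; first by rewrite bicommC sw ?a0.
have := tw (x :: t); rewrite big_cons mulrC bicommM; apply.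
by rewrite /= tk.
Qed.

Lemma ideal_acts_trivially v :
  v != 0 -> (forall z, ideal_op z v = 0) -> forall z w, rho (zeta z) w = 0.
Proof.
move=> v0 zv z w; pose U w := forall z, rho (zeta z) w = 0.
suff : U w by apply.
apply: (@irreducible_submodule _ _ _ rho U v) => //.
split=> [y|c u u' Uu Uu' y|x u Uu y]; first exact: linear_map0.
  by rewrite rho_lin Uu Uu' scaler0 addr0.
have [z' xy] := zeta_ideal x y; have := act_bracket rho_mod x (zeta y) u.
rewrite xy !Uu (linear_map0 (rho_lin x)) sub0r => /esym/eqP.
by rewrite oppr_eq0 => /eqP.
Qed.

End AbelianIdeal.

(** * One-forms modulo exact forms *)

Section BilinearExtension.
Variables (K : numFieldType) (n : nat).
Local Notation Zn := 'rV[int]_n.+1.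

Lemma lext0 (V W : lmodType K) (f : Zn -> V -> W) : lext f 0 = 0.
Proof.
rewrite /lext (_ : supp _ = set0) ?fsbig_set0 //.
by apply/seteqP; split=> // i /=; rewrite /supp /= eqxx.
Qed.

Variables (U V W : lmodType K) (f : Zn -> Zn -> U -> V -> W).

Lemma bext0r a : bext f a 0 = 0.
Proof. by rewrite /bext {1}/lext fsbig1 // => r _; exact: lext0. Qed.

Lemma bext0l b : bext f 0 b = 0.
Proof. exact: lext0. Qed.

Hypothesis f0l : forall r s v, f r s 0 v = 0.

Lemma bext_monol r u b :
  bext f (mono r u) b = lext (fun s v => mono (r + s) (f r s u v)) b.
Proof.
rewrite /bext lext_mono // => i.
by rewrite /lext fsbig1 // => s _; rewrite f0l linear0.
Qed.

Lemma bext_mono r s u v : (forall k, f r k u 0 = 0) ->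
  bext f (mono r u) (mono s v) = mono (r + s) (f r s u v).
Proof.
by move=> f0r; rewrite bext_monol lext_mono // => j; rewrite f0r linear0.
Qed.

End BilinearExtension.

Section KahlerQuotient.
Variables (K : numFieldType) (n : nat).
Local Notation Zn := 'rV[int]_n.+1.
Local Notation Kn := 'rV[K]_n.+1.
Implicit Types (u v : Kn) (r s k : Zn).

Lemma zvecD r s : zvec K (r + s) = zvec K r + zvec K s.
Proof. exact: map_mxD. Qed.

Lemma zvecN r : zvec K (- r) = - zvec K r.
Proof. exact: map_mxN. Qed.

Lemma zvec0 : zvec K (0 : Zn) = 0.
Proof. exact: map_mx0. Qed.

Lemma zvec_delta (i : 'I_n.+1) : zvec K (delta_mx 0 i) = delta_mx 0 i.
Proof. by rewrite /zvec map_delta_mx. Qed.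

Lemma evE u k : ev u k = dot u (zvec K k).
Proof. by apply: eq_bigr => i _; rewrite mxE. Qed.

Lemma dotDr u : {morph dot u : v v' / v + v'}.
Proof.
move=> v v'; rewrite /dot -big_split; apply: eq_bigr => i _.
by rewrite mxE mulrDr.
Qed.

Lemma dotZr u c v : dot u (c *: v) = c * dot u v.
Proof.
by rewrite /dot mulr_sumr; apply: eq_bigr => i _; rewrite mxE mulrCA.
Qed.

Lemma dot0r u : dot u 0 = 0.
Proof. by rewrite -(scale0r 0) dotZr mul0r. Qed.

Lemma dot0l v : dot 0 v = 0.
Proof. by rewrite /dot big1 // => i _; rewrite mxE mul0r. Qed.

Lemma dot_delta i v : dot (delta_mx 0 i) v = v 0 i.
Proof.
rewrite /dot (bigD1 i) //= big1 => [|l li]; last by rewrite mxE (negPf li) mul0r.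
by rewrite mxE !eqxx mul1r addr0.
Qed.

Lemma Witt_Omega_linear r u : linear (Witt_Omega (mono r u)).
Proof.
have h : (fun b => Witt_Omega (mono r u) b) =
    lext (fun s v => mono (r + s) (ev u s *: v + dot u v *: zvec K r)).
  apply/funext => b; apply: bext_monol => r' s v.
  by rewrite evE !dot0l !scale0r addr0.
rewrite -[X in linear X]/(fun b => Witt_Omega (mono r u) b) h.
apply: lext_linear => s c v v'; rewrite dotDr dotZr -linearP; congr mono.
by rewrite !scalerDr scalerDl !scalerA (mulrC c (ev u s)) addrACA.
Qed.

Lemma Witt_Omega_mono r s u v : Witt_Omega (mono r u) (mono s v) =
  mono (r + s) (ev u s *: v + dot u v *: zvec K r).
Proof.
apply: bext_mono => [r' s' w|k]; last by rewrite dot0r scale0r scaler0 addr0.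
by rewrite evE !dot0l !scale0r addr0.
Qed.

Lemma dform_mono k (c : K^o) :
  dform (mono k c : Laur K n) = mono k ((c : K) *: zvec K k).
Proof. by rewrite /dform lext_mono // => j; rewrite scale0r linear0. Qed.

(** Vector fields commute with the differential. This is what makes [Witt_Z]
computable on classes, since its definition goes through representatives. *)
Lemma Witt_Omega_exact r u w : w \in @exact K n ->
  Witt_Omega (mono r u) w \in @exact K n.
Proof.
move=> /asboolP[a ->] {w}.
elim/laurent_ind: a => [|a b aE bE|k c].
- rewrite (linear_map0 (@dform_linear K n)) (linear_map0 (Witt_Omega_linear r u)).
  exact: rpred0.
- rewrite (linear_mapD (@dform_linear K n)) (linear_mapD (Witt_Omega_linear r u)).
  exact: rpredD.
apply/asboolP; exists (mono (r + k) ((ev u k * c : K) : K^o)).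
rewrite !dform_mono Witt_Omega_mono dotZr -evE zvecD scalerDr scalerA.
by congr mono; rewrite addrC (mulrC c).
Qed.

Definition KZ u k : Zquot K n := Zpi (mono k u).

Lemma KZ_linear k : linear (KZ^~ k).
Proof. by move=> c u v; rewrite /KZ !linearP. Qed.

Lemma KZ_diag k : KZ (zvec K k) k = 0.
Proof.
rewrite -(linear0 (@Zpi K n)); apply/Zpi_eq; rewrite subr0.
by apply/asboolP; exists (mono k (1 : K^o)); rewrite dform_mono scale1r.
Qed.

Lemma KZ_ind (P : Zquot K n -> Prop) :
  P 0 -> (forall z z', P z -> P z' -> P (z + z')) ->
  (forall u k, P (KZ u k)) -> forall z, P z.
Proof.
move=> P0 PD PK; apply: Zpi_ind => w.
elim/laurent_ind: w => [|a b Pa Pb|k u]; first by rewrite linear0.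
  by rewrite linearD; apply: PD.
exact: PK.
Qed.

Lemma Witt_Z_KZ r s u v : Witt_Z (mono r u) (KZ v s) =
  KZ (dot u (zvec K s) *: v + dot u v *: zvec K r) (r + s).
Proof.
rewrite -evE /KZ -Witt_Omega_mono; apply/Zpi_eq.
rewrite -(linear_mapB (Witt_Omega_linear r u)).
by apply/Witt_Omega_exact/Zpi_eq; rewrite Zpi_repr.
Qed.

Lemma Witt_Z0 (z : Zquot K n) : Witt_Z 0 z = 0.
Proof. by rewrite /Witt_Z /Witt_Omega bext0l linear0. Qed.

End KahlerQuotient.

(** * Cuspidal modules *)

Lemma direct_sum_eq0 (K : numFieldType) n (V : lmodType K)
    (U : 'rV[int]_n.+1 -> set V) (h : V -> V) :
  linear h -> direct_sum U -> (forall m v, U m v -> h v = 0) ->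
  forall v, h v = 0.
Proof.
move=> hl dU hU v; have [a [[aU ->] _]] := dU v.
rewrite fsbig_finite; last exact: laurent_finite.
rewrite (big_morph h (linear_mapD hl) (linear_map0 hl)).
by apply: big1 => m _; apply: hU (aU m).
Qed.

Lemma direct_sum_neq0 (K : numFieldType) n (V : lmodType K)
    (U : 'rV[int]_n.+1 -> set V) (v : V) :
  direct_sum U -> v != 0 -> exists m w, U m w /\ w != 0.
Proof.
move=> dU v0; apply: contrapT => Uw; move/eqP: v0; apply.
apply: (@direct_sum_eq0 _ _ _ _ id _ dU) => // m w Umw.
by apply: contrapT => /eqP w0; apply: Uw; exists m, w.
Qed.

Section Center.
Variables (K : numClosedFieldType) (n : nat) (n_gt0 : (0 < n)%N).
Variables (L : lmodType K) (br : L -> L -> L).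
Variables (V : lmodType K) (rho : L -> V -> V).
Hypotheses (rho_mod : lie_module br rho) (rho_irr : irreducible_module rho).
Variables (zeta : Zquot K n -> L) (omega : Witt K n -> L).
Hypothesis zeta_lin : linear zeta.
Hypothesis zeta_abelian : forall z z', br (zeta z) (zeta z') = 0.
Hypothesis zeta_ideal : forall x z, exists z', br x (zeta z) = zeta z'.
Hypothesis omega_zeta : forall w z, br (omega w) (zeta z) = zeta (Witt_Z w z).
Hypothesis V_cuspidal : cuspidal (fun i => rho (omega (td K 0 i))).

Local Notation Zn := 'rV[int]_n.+1.
Local Notation Kn := 'rV[K]_n.+1.
Local Notation A := (bicommutant (ideal_ops_comm rho_mod zeta_abelian)).
Local Notation ad := (@ad _ _ _ _ _ rho_mod _ _ zeta_abelian zeta_ideal).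
Local Notation ez i := (delta_mx 0 i : Zn).
Local Notation ek i := (delta_mx 0 i : Kn).
Local Notation D r u := (omega (mono r u)).

Definition zop (u : Kn) (k : Zn) : A := ideal_op rho_mod zeta_abelian (KZ u k).

Lemma zop_linear k : linear (zop^~ k).
Proof.
move=> c u v; apply: bicomm_ext => x.
by rewrite bicommD bicommZ !ideal_opE KZ_linear zeta_lin (act_linearl rho_mod).
Qed.

Lemma zop_diag k : zop (zvec K k) k = 0.
Proof.
apply: bicomm_ext => x.
by rewrite ideal_opE KZ_diag (linear_map0 zeta_lin) (rho0 rho_mod).
Qed.

Lemma ad_zop r s u v : ad (D r u) (zop v s) =
  zop (dot u (zvec K s) *: v + dot u v *: zvec K r) (r + s).
Proof. by apply: ad_ideal_op; rewrite omega_zeta Witt_Z_KZ. Qed.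

(** On the component of degree [s], [dgr i] is multiplication by [s 0 i];
the operators on which all [dgr i] vanish preserve the weight spaces. *)
Definition dgr i : A -> A := ad (omega (td K 0 i)).

Lemma dgr_zop i v s : dgr i (zop v s) = (s 0 i)%:~R *: zop v s.
Proof.
rewrite /dgr /td ad_zop zvec0 scaler0 addr0 add0r dot_delta mxE.
by rewrite (linear_mapZ (zop_linear s)).
Qed.

(** An eigenvalue exists because weight spaces are finite-dimensional; the
exponent is uniform because their dimensions are bounded. *)
Lemma degree0_nilpotent (f : A) : (forall i, dgr i f = 0) ->
  exists c : K, nilpotent (f - c *: (1 : A)).
Proof.
move=> f0; have [lam [[dsum _] [N dimN]]] := V_cuspidal.
have wt (g : A) m v : (forall i, dgr i g = 0) ->
    weight_space (fun i => rho (omega (td K 0 i))) (lam + zvec K m) v ->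
    weight_space (fun i => rho (omega (td K 0 i))) (lam + zvec K m) (g v).
  move=> g0 wv i; have /eqP := congr1 (fun h : A => h v) (g0 i).
  rewrite /dgr adE bicomm0 subr_eq0 => /eqP ->; rewrite wv.
  by rewrite (linear_mapZ (bicomm_linear g)).
have [[v0 v0N0] _] := rho_irr.
have [m [v [wv vN0]]] := direct_sum_neq0 dsum v0N0.
have wfv i : weight_space (fun i => rho (omega (td K 0 i)))
    (lam + zvec K m) (iter i f v) by elim: i => //= i; apply: wt.
have [c [[i0 i0N ci0] sum0]] := dim_le_dependent (dimN m) wfv.
pose p := \poly_(i < N.+1) c i.
have p0 : p != 0.
  by apply: contra_neq ci0 => /(congr1 (coefp i0)); rewrite /= coef_poly ltnS i0N coef0.
have [|lambda [w [w0 fw]]] := eigenvector_of_annihilator (bicomm_linear f) vN0 p0.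
  rewrite (poly_act_widen _ _ (size_poly _ _)) -[RHS]sum0.
  by apply: eq_bigr => i _; rewrite coef_poly ltn_ord.
exists lambda; exists N; set g := f - _.
have gw : g w = 0 by rewrite bicommD bicommN bicommZ bicomm1 fw subrr.
have g0 i : dgr i g = 0.
  rewrite /dgr (derivationD (ad_derivation _ _ _ _)).
  rewrite (derivationN (ad_derivation rho_mod zeta_abelian zeta_ideal)) adZ.
  rewrite (derivation1 (ad_derivation rho_mod zeta_abelian zeta_ideal)).
  by rewrite scaler0 subr0; exact: f0.
have iterE k u : (g ^+ k) u = iter k g u.
  by elim: k => // k IH; rewrite exprS bicommM IH.
apply: bicomm_ext => u; rewrite bicomm0.
apply: (direct_sum_eq0 (bicomm_linear _) dsum) => l u' wu'.
have [k gk] := generalized_kernel_full rho_irr zeta_ideal w0 gw u'.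
rewrite iterE; rewrite iterE in gk.
apply: locally_nilpotent_bound (bicomm_linear g) (dimN l) _ wu' gk => x.
exact: wt.
Qed.

Lemma zop_nilpotent i j : i != j -> nilpotent (zop (ek i) (ez j)).
Proof.
move=> ij; set a := zop _ _.
pose a' := zop (ek i) (- ez j); pose b := zop (ek i) (ez i - ez j *+ 2).
have [c aac] : exists c : K, nilpotent (a * a' - c *: (1 : A)).
  apply: degree0_nilpotent => l; rewrite /dgr (derivationM (ad_derivation _ _ _ _)).
  rewrite -!/(dgr _ _) !dgr_zop bicomm_scaleAl bicomm_scaleAr -scalerDl !mxE.
  by rewrite rmorphN addrN scale0r.
(* The degrees of the two fields are forced by e_j + (e_i - e_j) = e_i, where
   K(e_i, e_i) = 0, and (e_i - 2 e_j) + (3 e_j - e_i) = e_j. *)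
apply: (@nilpotent_of_pair A L ad _ _ (D (ez i - ez j) (ek j))
  (D (ez j *+ 3 - ez i) (ek j)) a a' b (c *: (1 : A))) => //.
- exact: ad_derivation.
- exact: bicomm_torsion_free.
- rewrite adZ (derivation1 (ad_derivation rho_mod zeta_abelian zeta_ideal)).
  by rewrite scaler0.
- rewrite ad_zop subrK !dot_delta zvec_delta !mxE !eqxx eq_sym (negPf ij).
  by rewrite scale1r scale0r addr0 -zvec_delta zop_diag.
- rewrite ad_zop !dot_delta zvecN zvec_delta !mxE !eqxx eq_sym (negPf ij).
  rewrite scale0r addr0 scaleN1r (linear_mapN (zop_linear _)) /b.
  by rewrite mulr2n opprD addrA.
- rewrite ad_zop !dot_delta !mxE !eqxx eq_sym (negPf ij) scale0r addr0.
  rewrite /= sub0r rmorphN /= scaleNr (linear_mapN (zop_linear _)).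
  rewrite addrA subrK -mulrnBr // (_ : 3 - 2 = 1)%N // mulr1n; congr (- _).
  by rewrite (linear_mapZ (zop_linear _)) -[RHS]scaler_nat rmorphD.
Qed.

Theorem central_ideal_acts_trivially z v : rho (zeta z) v = 0.
Proof.
pose s := [seq zop (ek i) (ez ord0) | i <- enum 'I_n.+1 & i != ord0].
have [|x [x0 sx]] := common_kernel_of_nilpotents rho_irr zeta_ideal (s := s).
  by move=> _ /mapP[i + ->]; rewrite mem_filter => /andP[i0 _]; apply: zop_nilpotent.
have ad_s i y : i != ord0 -> ad y (zop (ek i) (ez ord0)) x = 0.
  by move=> i0; apply: sx; apply: map_f; rewrite mem_filter i0 mem_enum.
(* K(e_i, k) is a derivative of K(e_i, e_0) when i != 0. For i = 0, a field in
   another direction d_l maps K(e_l, e_0) to K(k - e_0, k) = - K(e_0, k); this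
   needs at least two variables. *)
have e_kill i k : zop (ek i) k x = 0.
  have [->|i0] := eqVneq i ord0.
    have m0 : (ord_max : 'I_n.+1) != ord0 by rewrite -val_eqE /= -lt0n.
    have := ad_s ord_max (D (k - ez ord0) (ek ord_max)) m0.
    rewrite ad_zop !dot_delta !mxE !eqxx (negPf m0) scale0r add0r scale1r subrK.
    rewrite zvecD zvecN zvec_delta (linear_mapB (zop_linear _)) zop_diag sub0r.
    by rewrite bicommN => /eqP; rewrite oppr_eq0 => /eqP.
  have := ad_s i (D (k - ez ord0) (ek ord0)) i0.
  rewrite ad_zop !dot_delta !mxE !eqxx eq_sym (negPf i0) scale0r addr0 subrK.
  by rewrite scale1r.
apply: (ideal_acts_trivially rho_irr zeta_ideal x0) => {}z.
have zl y : linear (fun z => rho (zeta z) y).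
  by move=> c z1 z2; rewrite zeta_lin (act_linearl rho_mod).
rewrite ideal_opE; elim/KZ_ind: z => [|z1 z2 z10 z20|u k].
- exact: linear_map0 (zl x).
- by rewrite (linear_mapD (zl x)) z10 z20 addr0.
rewrite [LHS](_ : _ = zop u k x) // (row_sum_delta u).
rewrite (big_morph (fun u => zop u k x) (id1 := 0) (op1 := +%R)).
- by rewrite big1 // => i _; rewrite (linear_mapZ (zop_linear k)) bicommZ e_kill scaler0.
- by move=> u1 u2; rewrite (linear_mapD (zop_linear k)).
- by rewrite (linear_map0 (zop_linear k)).
Qed.

End Center.

Section Brackets.
Variables (K : numFieldType) (n : nat) (c1 c2 : K).

Lemma vir_br_Z (x : vir K n) z :
  vir_br c1 c2 x (vir_Z z) = vir_Z (Witt_Z x.2 z).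
Proof.
rewrite /vir_br /vir_Z /=; congr (_, _); last exact: bext0r.
rewrite Witt_Z0 subr0 /phi /phi1 /phi2 !bext0r !linear0.
by rewrite !addr0.
Qed.

Variables (g : vectType K) (br : g -> g -> g) (form : g -> g -> K).

Lemma tor_br_Z (x : toroidal n g) z :
  tor_br br form c1 c2 x (tor_vir g (vir_Z z)) =
  tor_vir g (vir_Z (Witt_Z x.2.2 z)).
Proof.
rewrite /tor_br /tor_vir /= vir_br_Z /loop_br /Witt_loop /loop_cocycle.
rewrite !bext0r bext0l subr0 addr0 linear0; congr (_, _).
by rewrite -[RHS]add0r.
Qed.

End Brackets.

Local Open Scope complex_scope.

Theorem theorem3p12 (R : realType) (n : nat) (n_ge1 : (1 <= n)%N)
    (g : vectType R[i]) (br : g -> g -> g) (form : g -> g -> R[i])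
    (br_lie : lie_bracket br) (br_simple : simple_lie br)
    (form_inv : invariant_form br form) (c1 c2 : R[i]) :
  (forall (V : lmodType R[i]) (rho : vir R[i] n -> V -> V),
     lie_module (vir_br c1 c2) rho ->
     irreducible_module rho ->
     cuspidal (fun i => rho (vir_W (td R[i] 0 i))) ->
     forall (z : Zquot R[i] n) (v : V), rho (vir_Z z) v = 0) /\
  (forall (V : lmodType R[i]) (rho : toroidal n g -> V -> V),
     lie_module (tor_br br form c1 c2) rho ->
     irreducible_module rho ->
     cuspidal (fun i => rho (tor_vir g (vir_W (td R[i] 0 i)))) ->
     forall (z : Zquot R[i] n) (v : V), rho (tor_vir g (vir_Z z)) v = 0).
Proof.
split=> V rho rho_mod rho_irr cusp.
  apply: (@central_ideal_acts_trivially _ n n_ge1 _ _ V rho rho_mod rho_irr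
    (@vir_Z _ n) (@vir_W _ n)) => //.
  - by move=> c z z'; rewrite /vir_Z -[RHS]/(c *: z + z', c *: 0 + 0) scaler0 addr0.
  - by move=> z z'; rewrite vir_br_Z Witt_Z0.
  - by move=> x z; exists (Witt_Z x.2 z); apply: vir_br_Z.
  - by move=> w z; apply: vir_br_Z.
apply: (@central_ideal_acts_trivially _ n n_ge1 _ _ V rho rho_mod rho_irr
  (fun z => tor_vir g (vir_Z z)) (fun w => tor_vir g (vir_W w))) => //.
- move=> c z z'; rewrite /tor_vir /vir_Z.
  by rewrite -[RHS]/(c *: 0 + 0, (c *: z + z', c *: 0 + 0)) !scaler0 !addr0.
- by move=> z z'; rewrite tor_br_Z Witt_Z0.
- by move=> x z; exists (Witt_Z x.2.2 z); apply: tor_br_Z.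
- by move=> w z; apply: tor_br_Z.
Qed.
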